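(* Let $R$ be a semiprime ring, let $I$ be a nonzero ideal of $R$, and let $d:R\to R$ be a multiplicative semiderivation associated with a nonzero epimorphism $g$ of $R$. If $d(xy)\pm yx=0$ for all $x,y\in I$ (that is, either $d(xy)+yx=0$ for all $x,y\in I$, or $d(xy)-yx=0$ for all $x,y\in I$), then $[x,d(x)]=0$ for all $x\in I$.
   Context: Rings are associative and not assumed unital or commutative; ideals are two-sided. A ring $R$ is semiprime if for $x\in R$, $xRx=0$ implies $x=0$. For $x,y\in R$, $[x,y]=xy-yx$. A mapping $d:R\to R$ (not assumed additive) is a multiplicative semiderivation associated with a function $g:R\to R$ if (i) $d(xy)=d(x)g(y)+xd(y)=d(x)y+g(x)d(y)$ and (ii) $d(g(x))=g(d(x))$ hold for all $x,y\in R$. An epimorphism of $R$ is a surjective ring homomorphism $R\to R$; nonzero means not the zero map. *)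

(* Defs.v *)
From HB Require Import structures.
From mathcomp Require Import all_boot all_algebra.
From mathcomp Require Import classical_sets.

Set Implicit Arguments.
Unset Strict Implicit.
Unset Printing Implicit Defensive.

Local Open Scope ring_scope.

(* The ring structures of ssralg all have a unit; a ring without unit is built
   here as an additive group with a distributive semigroup law.  Its product is
   thus the semigroup product [(x * y)%g], not [GRing.mul]. *)
HB.mixin Record isRng R of GRing.Zmodule R & Semigroup R := {
  rng_mulDl : forall x y z : R, ((x + y) * z)%g = (x * z)%g + (y * z)%g;
  rng_mulDr : forall x y z : R, (x * (y + z))%g = (x * y)%g + (x * z)%g;
}.

#[short(type="rngType")]
HB.structure Definition Rng := {R of isRng R & GRing.Zmodule R & Semigroup R}.

Definition semiprime (R : rngType) : Prop :=
  forall x : R, (forall r : R, (x * r * x)%g = 0) -> x = 0.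

Definition rng_commutator (R : rngType) (x y : R) : R := (x * y)%g - (y * x)%g.

Definition two_sided_ideal (R : rngType) (I : set R) : Prop :=
  [/\ I 0,
      forall x y, I x -> I y -> I (x - y)
    & forall r x, I x -> I (r * x)%g /\ I (x * r)%g].

Definition epimorphism (R : rngType) (g : R -> R) : Prop :=
  [/\ {morph g : x y / x + y},
      {morph g : x y / (x * y)%g}
    & forall y, exists x, g x = y].

(* [d] is deliberately not required to be additive. *)
Definition multiplicative_semiderivation (R : rngType) (d g : R -> R) : Prop :=
  (forall x y, d (x * y)%g = (d x * g y)%g + (x * d y)%g
            /\ d (x * y)%g = (d x * y)%g + (g x * d y)%g)
  /\ (forall x, d (g x) = g (d x)).

(* Main.v *)
(* Computing [d(xyz)] as [d(x(yz))] and as [d((xy)z)] gives [yzx = zxy] on [I],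
   so products of elements of [I] commute with [I].  Semiprimeness then makes
   [I] commutative, and a commutative ideal of a semiprime ring is central. *)
Require Import Defs.
From HB Require Import structures.
From mathcomp Require Import all_boot all_algebra.
From mathcomp Require Import classical_sets.

Set Implicit Arguments.
Unset Strict Implicit.
Unset Printing Implicit Defensive.

Local Open Scope ring_scope.

Import GRing.Theory.

Lemma rng_mul0l (R : rngType) (x : R) : (0 * x)%g = 0.
Proof. by apply: (addrI (0 * x)%g); rewrite -rng_mulDl !addr0. Qed.

Lemma rng_mulBl (R : rngType) (x y z : R) :
  ((x - y) * z)%g = (x * z)%g - (y * z)%g.
Proof. by apply: (addIr (y * z)%g); rewrite -rng_mulDl !subrK. Qed.

Lemma rng_mulBr (R : rngType) (x y z : R) :
  (x * (y - z))%g = (x * y)%g - (x * z)%g.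
Proof. by apply: (addIr (x * z)%g); rewrite -rng_mulDr !subrK. Qed.

Section SemiprimeIdeal.

Variables (R : rngType) (I : set R).
Hypotheses (R_semiprime : semiprime R) (I_ideal : two_sided_ideal I).

Let idealB x y : I x -> I y -> I (x - y).
Proof. by case: I_ideal => _ + _; apply. Qed.

Let idealMl r x : I x -> I (r * x)%g.
Proof. by case: I_ideal => _ _ /(_ r x) IM /IM []. Qed.

Let idealMr r x : I x -> I (x * r)%g.
Proof. by case: I_ideal => _ _ /(_ r x) IM /IM []. Qed.

(** For [y] in [I], also [r y] is in [I], so [x(ry) = (ry)x = r(yx) = r(xy)]; hence [c = [x, r]]
    satisfies [c y = 0]. Since [t c] lies in [I], this gives [c t c = 0] for all [t]. *)
Lemma commutative_ideal_central :
  (forall x y, I x -> I y -> (x * y = y * x)%g) ->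
  forall x r, I x -> rng_commutator x r = 0.
Proof.
move=> IC x r Ix; set c := rng_commutator x r.
have Ic : I c by apply: idealB; [apply: idealMr | apply: idealMl].
have cI y : I y -> (c * y)%g = 0.
  move=> Iy; rewrite /c /rng_commutator rng_mulBl -!mulgA.
  by rewrite (IC x (r * y)%g Ix (idealMl r Iy)) -mulgA (IC y x) // subrr.
by apply: R_semiprime => t; rewrite -mulgA cI //; apply: idealMl.
Qed.

(** Semiprimeness is used twice, for [a] and then for [a r a]: the product [(a r a) t (a r a)]
    begins with [(a r)(a t) a], where [a r] and [a t] lie in [I]. *)
Lemma ideal_square_annihilator (a : R) :
  I a -> (forall x y, I x -> I y -> (x * y * a)%g = 0) -> a = 0.
Proof.
move=> Ia IIa; apply: R_semiprime => r; apply: R_semiprime => t.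
have -> : (a * r * a * t * (a * r * a) = a * r * (a * t) * a * (r * a))%g.
  by rewrite !mulgA.
by rewrite IIa ?rng_mul0l //; apply: idealMr.
Qed.

(** The commutator [[w, y]] is killed on the left by [z x]: moving [y] to the front turns both
    [z(xw)y] and [(zxy)w] into [yzxw]. *)
Lemma ideal_commutative_of_cyclic :
  (forall x y z, I x -> I y -> I z -> (y * z * x = z * x * y)%g) ->
  forall x y, I x -> I y -> (x * y = y * x)%g.
Proof.
move=> cyc w y Iw Iy; apply/eqP; rewrite -subr_eq0; apply/eqP.
apply: ideal_square_annihilator => [|z x Iz Ix].
  by apply: idealB; apply: idealMr.
rewrite rng_mulBr !mulgA -(cyc x y z) // -(mulgA z x w).
by rewrite -(cyc (x * w)%g y z) ?mulgA ?subrr //; apply: idealMr.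
Qed.

End SemiprimeIdeal.

Theorem theorem4 (R : rngType) (I : set R) (d g : R -> R)
    (R_semiprime : semiprime R)
    (I_ideal : two_sided_ideal I)
    (I_nonzero : exists x, I x /\ x <> 0)
    (g_epi : epimorphism g)
    (g_nonzero : exists x, g x <> 0)
    (d_semider : multiplicative_semiderivation d g)
    (d_id : (forall x y, I x -> I y -> d (x * y)%g + (y * x)%g = 0)
         \/ (forall x y, I x -> I y -> d (x * y)%g - (y * x)%g = 0)) :
  forall x, I x -> rng_commutator x (d x) = 0.
Proof.
(* [d x] is not known to lie in [I], so centrality of [I] in the whole ring is what applies. *)
move=> x; apply: commutative_ideal_central => // {x}.
apply: ideal_commutative_of_cyclic => // x y z Ix Iy Iz.
have [_ _ IM] := I_ideal.
have Iyz : I (y * z)%g by have [] := IM z y Iy.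
have Ixy : I (x * y)%g by have [] := IM y x Ix.
have -> : (z * x * y = z * (x * y))%g by rewrite mulgA.
(* The [0] in the identity for [x(yz)] is replaced by the left side of the identity for [(xy)z],
   leaving [d(xyz)] as a common summand to cancel. *)
case: d_id => d_id; have := d_id _ _ Ix Iyz; rewrite mulgA -(d_id _ _ Ixy Iz).
  exact: addrI.
by move/addrI/oppr_inj.
Qed.
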